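(* Let $\mathcal{G}$ be a hereditary graph class that does not contain all clique partition graphs. Then $\mathcal{G}$ is $(\mathrm{tw},\omega)$-bounded if and only if $\mathcal{G}$ has bounded tree-independence number.
   Context: All graphs are finite, simple and undirected. A class is hereditary if it is closed under taking induced subgraphs. A clique partition graph is a disjoint union of complete graphs. A tree decomposition of $G$ is a pair $(T,\{X_t\}_{t\in V(T)})$ with $T$ a tree and bags $X_t\subseteq V(G)$ such that every vertex lies in some bag, every edge has both endpoints in some bag, and for each vertex $v$ the nodes whose bags contain $v$ induce a connected subtree. The tree-independence number $\mathsf{tree}\text{-}\alpha(G)$ is the minimum over tree decompositions of $\max_t\alpha(G[X_t])$; a class has bounded tree-independence number if some constant bounds it for all members. A class $\mathcal{G}$ is $(\mathrm{tw},\omega)$-bounded if there is a function $f:\mathbb{N}\to\mathbb{N}$ such that for every $G\in\mathcal{G}$ and every induced subgraph $G'$ of $G$, $\mathrm{tw}(G')\le f(\omega(G'))$, where $\mathrm{tw}$ is treewidth and $\omega$ clique number. *)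

(* Defs.v *)
From mathcomp Require Import all_boot.
From mathcomp Require Import boolp.

Set Implicit Arguments.
Unset Strict Implicit.
Unset Printing Implicit Defensive.

Record sgraph := SGraph {
  vertex :> finType;
  adj : rel vertex;
  adj_sym : symmetric adj;
  adj_irrefl : irreflexive adj
}.

Definition isomorphic (G H : sgraph) : Prop :=
  exists f : G -> H, bijective f /\ forall x y, adj (f x) (f y) = adj x y.

Section Induced.
Variables (G : sgraph) (S : {set G}).

Definition induced_adj : rel {x : G | x \in S} :=
  fun x y => adj (val x) (val y).

Lemma induced_adj_sym : symmetric induced_adj.
Proof. by move=> x y; apply: adj_sym. Qed.

Lemma induced_adj_irrefl : irreflexive induced_adj.
Proof. by move=> x; apply: adj_irrefl. Qed.

Definition induced : sgraph := SGraph induced_adj_sym induced_adj_irrefl.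
End Induced.

Section Complete.
Variable n : nat.

Definition complete_adj : rel 'I_n := fun x y => x != y.

Lemma complete_adj_sym : symmetric complete_adj.
Proof. by move=> x y; rewrite /complete_adj eq_sym. Qed.

Lemma complete_adj_irrefl : irreflexive complete_adj.
Proof. by move=> x; rewrite /complete_adj eqxx. Qed.

Definition complete_graph : sgraph :=
  SGraph complete_adj_sym complete_adj_irrefl.
End Complete.

Section DisjointUnion.
Variables (I : finType) (G : I -> sgraph).

(* [tagged_as u v] is the component of [v] transported to [G (tag u)]; it is
   meaningful only when the tags agree. *)
Definition disjoint_union_adj : rel {i : I & G i} :=
  fun u v => (tag u == tag v) && adj (tagged u) (tagged_as u v).

Lemma disjoint_union_adj_sym : symmetric disjoint_union_adj.
Proof.
move=> [i x] [j y]; rewrite /disjoint_union_adj /= eq_sym.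
case: eqP => //= eji; move: x; case: i / eji => x.
by rewrite !tagged_asE adj_sym.
Qed.

Lemma disjoint_union_adj_irrefl : irreflexive disjoint_union_adj.
Proof.
by move=> [i x]; rewrite /disjoint_union_adj /= tagged_asE adj_irrefl andbF.
Qed.

Definition disjoint_union : sgraph :=
  SGraph disjoint_union_adj_sym disjoint_union_adj_irrefl.
End DisjointUnion.

Definition clique_partition_graph (G : sgraph) : Prop :=
  exists (I : finType) (n : I -> nat),
    isomorphic G (disjoint_union (fun i => complete_graph (n i))).

Definition is_stable (G : sgraph) (S : {set G}) : bool :=
  [forall x in S, forall y in S, ~~ adj x y].

Definition is_clique (G : sgraph) (S : {set G}) : bool :=
  [forall x in S, forall y in S, (x != y) ==> adj x y].

Definition independence_number (G : sgraph) : nat :=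
  \max_(S : {set G} | is_stable S) #|S|.

Definition clique_number (G : sgraph) : nat :=
  \max_(S : {set G} | is_clique S) #|S|.

Definition connected_graph (G : sgraph) : Prop :=
  0 < #|G| /\ forall x y : G, connect (@adj G) x y.

Definition acyclic_graph (G : sgraph) : Prop :=
  forall c : seq G, 2 < size c -> ~ ucycle (@adj G) c.

Definition is_tree (T : sgraph) : Prop := connected_graph T /\ acyclic_graph T.

Record is_tree_decomposition (G T : sgraph) (X : T -> {set G}) : Prop := {
  td_tree : is_tree T;
  td_vertex : forall v : G, exists t : T, v \in X t;
  td_edge : forall u v : G, adj u v -> exists t : T, (u \in X t) && (v \in X t);
  td_connected : forall v : G, connected_graph (induced [set t | v \in X t])
}.

(* The predecessor is truncated: the graph without vertices gets width 0
   instead of -1. *)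
Definition td_width (G T : sgraph) (X : T -> {set G}) : nat :=
  (\max_(t : T) #|X t|).-1.

Definition td_independence_number (G T : sgraph) (X : T -> {set G}) : nat :=
  \max_(t : T) independence_number (induced (X t)).

Lemma trivial_tree_decomposition (G : sgraph) :
  is_tree_decomposition (fun _ : complete_graph 1 => [set: G]).
Proof.
split.
- split; first by split=> [|x y]; [rewrite card_ord | rewrite !ord1 connect0].
  move=> c c_gt2 /andP[_ /card_uniqP c_uniq].
  by move: (max_card (mem c)); rewrite c_uniq card_ord leqNgt ltnW.
- by move=> v; exists ord0; rewrite inE.
- by move=> u v _; exists ord0; rewrite !inE.
- move=> v; have v0 : ord0 \in [set t : complete_graph 1 | v \in [set: G]].
    by rewrite !inE.
  split; first by apply/card_gt0P; exists (exist _ ord0 v0).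
  move=> x y; suff -> : x = y by rewrite connect0.
  by apply: val_inj; rewrite !ord1.
Qed.

Definition treewidth_value (G : sgraph) : pred nat := fun k =>
  `[< exists (T : sgraph) (X : T -> {set G}),
        is_tree_decomposition X /\ td_width X = k >].

Definition tree_alpha_value (G : sgraph) : pred nat := fun k =>
  `[< exists (T : sgraph) (X : T -> {set G}),
        is_tree_decomposition X /\ td_independence_number X = k >].

Lemma treewidth_value_ex (G : sgraph) : exists k, treewidth_value G k.
Proof.
eexists; apply/asboolP; exists (complete_graph 1), (fun=> setT).
by split; [apply: trivial_tree_decomposition |].
Qed.

Lemma tree_alpha_value_ex (G : sgraph) : exists k, tree_alpha_value G k.
Proof.
eexists; apply/asboolP; exists (complete_graph 1), (fun=> setT).
by split; [apply: trivial_tree_decomposition |].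
Qed.

Definition treewidth (G : sgraph) : nat := ex_minn (treewidth_value_ex G).

Definition tree_alpha (G : sgraph) : nat := ex_minn (tree_alpha_value_ex G).

(* A class of graphs is understood up to isomorphism. *)
Record graph_class := GraphClass {
  in_class :> sgraph -> Prop;
  in_class_iso : forall G H, isomorphic G H -> in_class G -> in_class H
}.

Definition hereditary (C : graph_class) : Prop :=
  forall G : sgraph, C G -> forall S : {set G}, C (induced S).

Definition contains_all_clique_partition_graphs (C : graph_class) : Prop :=
  forall G : sgraph, clique_partition_graph G -> C G.

Definition tw_omega_bounded (C : graph_class) : Prop :=
  exists f : nat -> nat, forall G : sgraph, C G -> forall S : {set G},
    treewidth (induced S) <= f (clique_number (induced S)).

Definition bounded_tree_alpha (C : graph_class) : Prop :=
  exists k : nat, forall G : sgraph, C G -> tree_alpha G <= k.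

(* Main.v *)
From mathcomp Require Import all_boot zify.
From mathcomp Require Import boolp.
Require Import Defs.

Set Implicit Arguments.
Unset Strict Implicit.
Unset Printing Implicit Defensive.

(** If all bags have independence number at most [k], Ramsey's theorem bounds
    their size in terms of the clique number.

    Conversely, let [G] be in a (tw, omega)-bounded class excluding some clique
    partition graph. For suitable [s] and [p], [G] has fewer than [s] pairwise
    anticomplete [s]-cliques and, [K_{p,p}] having clique number at most 2 and
    treewidth at least [p], no induced [K_{p,p}]. It suffices to find a set [D]
    of bounded independence number meeting all [s]-cliques: [G - D] then has
    bounded treewidth, and [D] can be added to all bags.

    For any weights on the [s]-cliques, some set [Z] of bounded independence
    number meets a constant fraction of the weight. Indeed, cliques carrying half
    of the weight touch a constant fraction of it, hence contain a heavy vertex: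
    one whose closed neighborhood meets a constant fraction of the weight. If
    the heavy vertices contain no large stable set, they form [Z]. Otherwise let
    [J] be such a stable set and [Z] the set of vertices with at least [p]
    neighbors in [J]: averaging over [J] shows that [Z] meets a constant
    fraction of the weight, and a large stable set in [Z] would give an induced
    [K_{p,p}] by pigeonhole.

    Multiplicative weights turn this into a sequence of sets [Z] such that every
    [s]-clique is met by a constant fraction of them, and [D] consists of the
    vertices lying in a constant fraction of the sets of the sequence. *)

(** * Independence and clique numbers of vertex sets *)

Lemma exists_subset_card (T : finType) (A : {set T}) n :
  n <= #|A| -> exists2 B : {set T}, B \subset A & #|B| = n.
Proof.
rewrite -bin_gt0 -cards_draws => /card_gt0P[B].
by rewrite inE => /andP[BA /eqP cardB]; exists B.
Qed.

Section LargestCard.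
Variables (T : finType) (P : pred {set T}).

Definition largest_card (S : {set T}) : nat :=
  \max_(J : {set T} | (J \subset S) && P J) #|J|.

Lemma largest_card_leP (S : {set T}) k :
  reflect (forall J : {set T}, J \subset S -> P J -> #|J| <= k)
          (largest_card S <= k).
Proof.
apply: (iffP (bigmax_leqP _ _ _)) => [le_k J JS PJ|le_k J /andP[]]; last exact: le_k.
by apply: le_k; rewrite JS.
Qed.

Lemma card_le_largest (S J : {set T}) : J \subset S -> P J -> #|J| <= largest_card S.
Proof. by move=> JS PJ; apply: (largest_card_leP _ _ (leqnn _)). Qed.

Lemma largest_cardS : {homo largest_card : A B / A \subset B >-> A <= B}.
Proof.
move=> A B AB; apply/largest_card_leP => J JA.
exact/card_le_largest/(subset_trans JA).
Qed.

Lemma largest_card_le_card (S : {set T}) : largest_card S <= #|S|.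
Proof. by apply/largest_card_leP => J /subset_leq_card. Qed.

Hypothesis P0 : P set0.
Hypothesis P_hereditary : forall A B : {set T}, A \subset B -> P B -> P A.

Lemma exists_card_largest n (S : {set T}) : n <= largest_card S ->
  exists2 J : {set T}, J \subset S & P J /\ #|J| = n.
Proof.
pose Q := [pred J : {set T} | (J \subset S) && P J].
have [|J /andP[JS PJ]] := @eq_bigmax_cond _ Q (fun J => #|J|).
  by apply/card_gt0P; exists set0; rewrite inE sub0set.
rewrite /largest_card => -> /exists_subset_card[K KJ cardK].
by exists K; [apply: subset_trans JS | split=> //; apply: P_hereditary PJ].
Qed.

Lemma largest_cardU (A B : {set T}) :
  largest_card (A :|: B) <= largest_card A + largest_card B.
Proof.
apply/largest_card_leP => J JAB PJ; rewrite -(cardsID A J) leq_add //.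
  by apply: card_le_largest (subsetIr _ _) (P_hereditary (subsetIl _ _) PJ).
by apply: card_le_largest (P_hereditary (subsetDl _ _) PJ); rewrite subDset.
Qed.

End LargestCard.

Lemma largest_card_imset (T T' : finType) (f : T -> T') (P : pred {set T'})
    (A : {set T}) :
  injective f ->
  largest_card P (f @: A) = largest_card (fun B : {set T} => P (f @: B)) A.
Proof.
move=> f_inj; apply/eqP; rewrite eqn_leq; apply/andP; split.
  apply/largest_card_leP => J JA PJ.
  have EJ : J = f @: (A :&: f @^-1: J).
    apply/setP => y; apply/idP/imsetP => [yJ|[x]]; last first.
      by rewrite !inE => /andP[_ xJ] ->.
    by have /imsetP[x xA Ey] := subsetP JA y yJ; exists x; rewrite // !inE xA -Ey.
  by rewrite EJ in PJ *; rewrite card_imset // card_le_largest ?subsetIl.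
apply/largest_card_leP => B BA PB.
by rewrite -(card_imset _ f_inj) card_le_largest ?imsetS.
Qed.

Lemma stableP (G : sgraph) (S : {set G}) :
  reflect {in S &, forall x y, ~~ adj x y} (is_stable S).
Proof.
apply: (iffP forall_inP) => [stS x y xS yS|stS x xS]; last first.
  by apply/forall_inP => y; apply: stS.
by move/forall_inP: (stS x xS); apply.
Qed.

Lemma cliqueP (G : sgraph) (S : {set G}) :
  reflect {in S &, forall x y, x != y -> adj x y} (is_clique S).
Proof.
apply: (iffP forall_inP) => [clS x y xS yS|clS x xS]; last first.
  by apply/forall_inP => y yS; apply/implyP; apply: clS.
by move/forall_inP: (clS x xS) => /(_ y yS) /implyP.
Qed.

Lemma stable0 (G : sgraph) : is_stable (set0 : {set G}).
Proof. by apply/stableP => x; rewrite inE. Qed.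

Lemma clique0 (G : sgraph) : is_clique (set0 : {set G}).
Proof. by apply/cliqueP => x; rewrite inE. Qed.

Lemma stableS (G : sgraph) (A B : {set G}) :
  A \subset B -> is_stable B -> is_stable A.
Proof. by move=> /subsetP AB /stableP stB; apply/stableP; apply: sub_in2 stB. Qed.

Lemma cliqueS (G : sgraph) (A B : {set G}) :
  A \subset B -> is_clique B -> is_clique A.
Proof. by move=> /subsetP AB /cliqueP clB; apply/cliqueP; apply: sub_in2 clB. Qed.

Lemma stableU1 (G : sgraph) (x : G) (J : {set G}) :
  is_stable J -> {in J, forall y, ~~ adj x y} -> is_stable (x |: J).
Proof.
move=> /stableP stJ xJ; apply/stableP => y z.
case/setU1P=> [->|yJ] /setU1P[->|zJ]; first by rewrite adj_irrefl.
- exact: xJ.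
- by rewrite adj_sym xJ.
exact: stJ.
Qed.

Lemma cliqueU1 (G : sgraph) (x : G) (K : {set G}) :
  is_clique K -> {in K, forall y, adj x y} -> is_clique (x |: K).
Proof.
move=> /cliqueP clK xK; apply/cliqueP => y z.
case/setU1P=> [->|yK] /setU1P[->|zK]; first by rewrite eqxx.
- by rewrite xK.
- by rewrite adj_sym xK.
exact: clK.
Qed.

Local Notation alpha := (largest_card (@is_stable _)).
Local Notation omega := (largest_card (@is_clique _)).

Section InducedSubgraph.
Variables (G : sgraph) (S : {set G}).

Lemma imset_val_setT : val @: [set: induced S] = S.
Proof.
apply/setP => x; apply/imsetP/idP => [[y _ ->]|xS]; first exact: valP.
by exists (exist _ x xS).
Qed.

Lemma card_induced : #|induced S| = #|S|.
Proof. by rewrite -cardsT -[in RHS]imset_val_setT (card_imset _ val_inj). Qed.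

Lemma stable_imset_val (A : {set induced S}) : is_stable (val @: A) = is_stable A.
Proof.
apply/stableP/stableP => [stA x y xA yA|stA _ _ /imsetP[x xA ->] /imsetP[y yA ->]].
  by apply: (stA (val x) (val y)); apply: imset_f.
exact: stA.
Qed.

Lemma clique_imset_val (A : {set induced S}) : is_clique (val @: A) = is_clique A.
Proof.
apply/cliqueP/cliqueP => [clA x y xA yA xy|clA _ _ /imsetP[x xA ->] /imsetP[y yA ->]].
  by apply: (clA (val x) (val y)); rewrite ?imset_f.
exact: clA.
Qed.

Lemma alpha_imset_val (A : {set induced S}) : alpha (val @: A) = alpha A.
Proof.
rewrite largest_card_imset; last exact: val_inj.
by apply: eq_bigl => B; rewrite stable_imset_val.
Qed.

Lemma omega_imset_val (A : {set induced S}) : omega (val @: A) = omega A.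
Proof.
rewrite largest_card_imset; last exact: val_inj.
by apply: eq_bigl => B; rewrite clique_imset_val.
Qed.

Lemma independence_number_induced : independence_number (induced S) = alpha S.
Proof.
rewrite -[in RHS]imset_val_setT alpha_imset_val.
by apply: eq_bigl => J; rewrite subsetT.
Qed.

Lemma clique_number_induced : clique_number (induced S) = omega S.
Proof.
rewrite -[in RHS]imset_val_setT omega_imset_val.
by apply: eq_bigl => K; rewrite subsetT.
Qed.

End InducedSubgraph.

Definition neighborhood (G : sgraph) (v : G) : {set G} := [set u | adj v u].

Definition closed_neighborhood (G : sgraph) (v : G) : {set G} :=
  v |: neighborhood v.

Lemma closed_neighborhood_sym (G : sgraph) (u v : G) :
  (u \in closed_neighborhood v) = (v \in closed_neighborhood u).
Proof. by rewrite !inE eq_sym adj_sym. Qed.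

Lemma omega_neighborhood (G : sgraph) (S : {set G}) (x : G) :
  x \in S -> omega (S :&: neighborhood x) < omega S.
Proof.
move=> xS; have [K /subsetIP[KS /subsetP Kx] [clK <-]] :=
  exists_card_largest (clique0 G) (@cliqueS G) (leqnn (omega (S :&: neighborhood x))).
have adjK : {in K, forall y, adj x y} by move=> y /Kx; rewrite inE.
have xK : x \notin K by apply/negP => /adjK; rewrite adj_irrefl.
have <- : #|x |: K| = #|K|.+1 by rewrite cardsU1 xK.
by apply: card_le_largest (cliqueU1 clK adjK); rewrite subUset sub1set xS.
Qed.

Lemma alpha_closed_neighborhood (G : sgraph) (S : {set G}) (x : G) :
  x \in S -> alpha (S :\: closed_neighborhood x) < alpha S.
Proof.
move=> xS; have [J /subsetDP[JS /disjointFr Jx] [stJ <-]] :=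
  exists_card_largest (stable0 G) (@stableS G)
    (leqnn (alpha (S :\: closed_neighborhood x))).
have nadjJ : {in J, forall y, ~~ adj x y}.
  by move=> y /Jx; rewrite !inE => /norP[].
have xJ : x \notin J by apply/negP => /Jx; rewrite setU11.
have <- : #|x |: J| = #|J|.+1 by rewrite cardsU1 xJ.
by apply: card_le_largest (stableU1 stJ nadjJ); rewrite subUset sub1set xS.
Qed.

Lemma ramsey (G : sgraph) (S : {set G}) : #|S| < 2 ^ (omega S + alpha S).
Proof.
have [n] := ubnP #|S|; elim: n S => // n IHn S cardS_lt.
have [->|[x xS]] := set_0Vmem S; first by rewrite cards0 expn_gt0.
pose N := S :&: neighborhood x; pose M := S :\: closed_neighborhood x.
have cardS : #|S| = (#|N| + #|M|).+1.
  rewrite -(cardsID (closed_neighborhood x)) setIUr (setIidPr _) ?sub1set //.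
  by rewrite cardsU1 !inE adj_irrefl andbF.
have IH (A : {set G}) : #|A| < #|S| -> omega A + alpha A < omega S + alpha S ->
    #|A| < 2 ^ (omega S + alpha S).-1.
  move=> AS lt_m; apply: leq_trans (IHn A (leq_trans AS cardS_lt)) _.
  by rewrite leq_exp2l // -ltnS (ltn_predK lt_m).
have N_lt : #|N| < 2 ^ (omega S + alpha S).-1.
  apply: IH; first by rewrite cardS ltnS leq_addr.
  by rewrite -addSn leq_add ?omega_neighborhood ?largest_cardS ?subsetIl.
have M_lt : #|M| < 2 ^ (omega S + alpha S).-1.
  apply: IH; first by rewrite cardS ltnS leq_addl.
  by rewrite -addnS leq_add ?alpha_closed_neighborhood ?largest_cardS ?subsetDl.
have sum_gt0 : 0 < omega S + alpha S.
  by rewrite addn_gt0 (leq_trans _ (omega_neighborhood xS)).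
rewrite cardS -(prednK sum_gt0) expnS; lia.
Qed.

(** * Tree decompositions *)

Definition restricted_adj (G : sgraph) (U : {set G}) : rel G :=
  [rel x y | [&& x \in U, y \in U & adj x y]].

Definition connected_in (G : sgraph) (U : {set G}) : Prop :=
  {in U &, forall x y, connect (restricted_adj U) x y}.

Lemma connect_induced (G : sgraph) (U : {set G}) (x y : induced U) :
  connect (@adj (induced U)) x y = connect (restricted_adj U) (val x) (val y).
Proof.
apply/connectP/connectP => [[p xp ->]|[p]].
  exists (map val p); last by rewrite last_map.
  apply: homo_path xp => u v uv.
  by apply/and3P; split; [exact: valP | exact: valP | ].
elim: p x => [|z p IHp] x; first by move=> _ /val_inj ->; exists [::].
case/andP=> /and3P[_ zU xz] zp /(IHp (exist _ z zU) zp)[q zq ->].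
by exists (exist _ z zU :: q) => //=; rewrite zq andbT.
Qed.

Lemma connected_graph_induced (G : sgraph) (U : {set G}) :
  connected_graph (induced U) <-> 0 < #|U| /\ connected_in U.
Proof.
rewrite /connected_graph card_induced.
split=> -[U_gt0 conn]; split=> // x y.
  by move=> xU yU; have := conn (exist _ x xU) (exist _ y yU); rewrite connect_induced.
by rewrite connect_induced; apply: conn; apply: valP.
Qed.

Lemma connected_in_setT (G : sgraph) : connected_graph G -> connected_in [set: G].
Proof.
case=> _ conn x y _ _; rewrite (@eq_connect _ _ (@adj G)) // => u v.
by rewrite /restricted_adj /= !inE.
Qed.

Definition leaf_in (G : sgraph) (U : {set G}) (t : G) : Prop :=
  {in U &, forall y z, adj t y -> adj t z -> y = z}.

Lemma acyclic_path_neighbor (G : sgraph) (x z : G) (p : seq G) :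
  acyclic_graph G -> path (@adj G) x p -> uniq (x :: p) ->
  adj x z -> z \in p -> z = head x p.
Proof.
move=> acG xp up xz zp; apply/eqP; apply: contraT => z_head.
case/splitPr: zp up xp z_head => p1 p2.
rewrite -!cat_rcons -cat_cons cat_uniq cat_path rcons_path.
move=> /andP[up1 _] /andP[/andP[xp1 lz] _] z_head.
case: (acG (x :: rcons p1 z)).
  by case: p1 z_head {up1 xp1 lz} => [|a p1] //=; rewrite ?eqxx // size_rcons.
by rewrite /ucycle up1 /= !rcons_path last_rcons xp1 lz adj_sym xz.
Qed.

(* The first vertex of a longest path is a leaf. *)
Lemma acyclic_exists_leaf (G : sgraph) (U : {set G}) :
  acyclic_graph G -> 0 < #|U| -> exists2 t, t \in U & leaf_in U t.
Proof.
move=> acG /card_gt0P[x0 x0U].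
pose path_in n := `[< exists x p,
  [/\ size p = n, x \in U, path (@adj G) x p & uniq (x :: p)] >].
have path_ex : exists n, path_in n by exists 0; apply/asboolP; exists x0, [::].
have path_bound n : path_in n -> n <= #|G|.
  case/asboolP=> x [p [<- _ _ /card_uniqP card_p]].
  by apply: leq_trans (max_card (mem (x :: p))); rewrite card_p leqnSn.
case: (ex_maxnP path_ex path_bound) => n /asboolP[x [p [sp xU xp up]]] n_max.
have neighbor_head y : y \in U -> adj x y -> y = head x p.
  move=> yU xy; apply: acyclic_path_neighbor (xy) _ => //.
  apply: contraT => yp; suff /n_max : path_in n.+1 by rewrite ltnn.
  apply/asboolP; exists y, (x :: p); split=> //=; first by rewrite sp.
    by rewrite adj_sym xy.
  rewrite -/(uniq (x :: p)) up inE negb_or yp !andbT.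
  by apply: contraTneq xy => ->; rewrite adj_irrefl.
by exists x => // y z yU zU /(neighbor_head y yU)-> /(neighbor_head z zU).
Qed.

Lemma connected_in_del_leaf (G : sgraph) (U : {set G}) (t : G) :
  leaf_in U t -> connected_in U -> connected_in (U :\ t).
Proof.
move=> leaf conn x y; rewrite !in_setD1 => /andP[xt xU] /andP[yt yU].
have /connectP[_ /shortenP[p xp up _] y_last] := conn x y xU yU.
have tp : t \notin p.
  apply/negP => tp; case/splitPr: tp up xp y_last => p1 [|b p2].
    by rewrite last_cat /= => _ _ yE; rewrite yE eqxx in yt.
  rewrite -cat_cons cat_uniq => /and3P[_ /hasPn /(_ b)].
  rewrite [b \in _]inE mem_head orbT => /(_ isT) bp1 _.
  rewrite cat_path => /andP[_ /= /and3P[/and3P[aU _ at_] /and3P[_ bU tb] _]] _.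
  move: bp1 => /=; rewrite -(leaf (last x p1) b aU bU _ tb) 1?adj_sym //.
  by rewrite mem_last.
apply/connectP; exists p => //.
apply: (sub_in_path (P := predC1 t)) xp => [u v ut vt /and3P[uU vU uv]|].
  by apply/and3P; rewrite !in_setD1 uU vU andbT andbT.
by rewrite /= xt; apply/allP => z zp; apply: contraNneq tp => <-.
Qed.

Record decomposition_on (G T : sgraph) (X : T -> {set G}) (U : {set T}) : Prop := {
  don_vertex : forall v, exists2 t, t \in U & v \in X t;
  don_edge : forall u v, adj u v -> exists2 t, t \in U & (u \in X t) && (v \in X t);
  don_connected : forall v, connected_in (U :&: [set t | v \in X t])
}.

Lemma tree_decomposition_on_setT (G T : sgraph) (X : T -> {set G}) :
  is_tree_decomposition X -> decomposition_on X [set: T].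
Proof.
case=> _ cover edge conn; split=> [v|u v /edge[t]|v].
- by have [t] := cover v; exists t.
- by exists t.
by rewrite setTI; have /connected_graph_induced[] := conn v.
Qed.

Lemma private_vertex_neighborhood (G T : sgraph) (X : T -> {set G}) (U : {set T})
    (t : T) (v : G) :
  decomposition_on X U -> t \in U -> v \in X t ->
  {in U, forall t', adj t t' -> v \notin X t'} -> closed_neighborhood v \subset X t.
Proof.
case=> _ edge conn tU vt private; rewrite subUset sub1set vt /=.
apply/subsetP => u; rewrite inE => /edge[t' t'U /andP[vt' ut']].
suff -> : t = t' by [].
have /connectP[[|a p] //=] : connect (restricted_adj (U :&: [set t | v \in X t])) t t'.
  by apply: conn; rewrite !inE ?tU ?t'U.
case/andP=> /and3P[_]; rewrite !inE => /andP[aU va] ta _ _.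
by rewrite (negPf (private a aU ta)) in va.
Qed.

Lemma decomposition_on_del_leaf (G T : sgraph) (X : T -> {set G}) (U : {set T})
    (t : T) :
  decomposition_on X U -> leaf_in U t ->
  {in X t, forall v, exists t', [/\ t' \in U, adj t t' & v \in X t']} ->
  decomposition_on X (U :\ t).
Proof.
case=> cover edge conn leaf shared.
have move_off u v t' : t' \in U -> u \in X t' -> v \in X t' ->
    exists2 t', t' \in U :\ t & (u \in X t') && (v \in X t').
  case: (eqVneq t' t) => [->|t't] t'U ut vt; last first.
    by exists t'; rewrite ?in_setD1 ?t't ?ut.
  have [[t1 [t1U tt1 ut1]] [t2 [t2U tt2 vt2]]] := (shared u ut, shared v vt).
  exists t1; last by rewrite ut1 (leaf t1 t2).
  by rewrite in_setD1 t1U andbT; apply: contraTneq tt1 => ->; rewrite adj_irrefl.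
split=> [v|u v /edge[t' t'U /andP[ut' vt']]|v].
- have [t' t'U vt'] := cover v.
  by have [t'' ? /andP[]] := move_off v v t' t'U vt' vt'; exists t''.
- exact: move_off vt'.
rewrite setIDAC; apply: connected_in_del_leaf (conn v).
by apply: sub_in2 leaf => t' /setIP[].
Qed.

(* Pruning leaves whose vertices all reappear in a neighboring bag must end at
   a leaf with a private vertex, whose neighbors are then all in the same bag. *)
Lemma bag_contains_closed_neighborhood (G T : sgraph) (X : T -> {set G}) :
  is_tree_decomposition X -> 0 < #|G| ->
  exists v t, closed_neighborhood v \subset X t.
Proof.
move=> tdX /card_gt0P[v0 _]; have [_ acT] := td_tree tdX.
suff on_nodes n (U : {set T}) : #|U| < n -> decomposition_on X U ->
    exists v t, closed_neighborhood v \subset X t.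
  exact: on_nodes (ltnSn _) (tree_decomposition_on_setT tdX).
elim: n U => // n IHn U cardU decU.
have [|t tU leaf] := acyclic_exists_leaf (U := U) acT.
  by have [t tU _] := don_vertex decU v0; apply/card_gt0P; exists t.
have [[v vt private]|no_private] := pselect (exists2 v, v \in X t &
    {in U, forall t', adj t t' -> v \notin X t'}).
  by exists v, t; apply: private_vertex_neighborhood private.
apply: (IHn (U :\ t)); first by rewrite (cardsD1 t) tU in cardU.
apply: decomposition_on_del_leaf => // v vt; apply: contrapT => unshared.
apply: no_private; exists v => // t' t'U tt'.
by apply/negP => vt'; apply: unshared; exists t'.
Qed.

Lemma treewidth_attained (G : sgraph) :
  exists (T : sgraph) (X : T -> {set G}),
    is_tree_decomposition X /\ td_width X = treewidth G.
Proof. by rewrite /treewidth; case: ex_minnP => m /asboolP. Qed.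

Lemma treewidth_le_td_width (G T : sgraph) (X : T -> {set G}) :
  is_tree_decomposition X -> treewidth G <= td_width X.
Proof.
move=> tdX; rewrite /treewidth; case: ex_minnP => m _; apply.
by apply/asboolP; exists T, X.
Qed.

Lemma tree_alpha_attained (G : sgraph) :
  exists (T : sgraph) (X : T -> {set G}),
    is_tree_decomposition X /\ td_independence_number X = tree_alpha G.
Proof. by rewrite /tree_alpha; case: ex_minnP => m /asboolP. Qed.

Lemma tree_alpha_le_td_independence_number (G T : sgraph) (X : T -> {set G}) :
  is_tree_decomposition X -> tree_alpha G <= td_independence_number X.
Proof.
move=> tdX; rewrite /tree_alpha; case: ex_minnP => m _; apply.
by apply/asboolP; exists T, X.
Qed.

Lemma tree_alpha_leP (G : sgraph) k :
  tree_alpha G <= k <-> exists (T : sgraph) (X : T -> {set G}),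
    is_tree_decomposition X /\ forall t, alpha (X t) <= k.
Proof.
split=> [|[T [X [tdX alphaX]]]].
  have [T [X [tdX <-]]] := tree_alpha_attained G => /bigmax_leqP alphaX.
  by exists T, X; split=> // t; rewrite -independence_number_induced alphaX.
apply: leq_trans (tree_alpha_le_td_independence_number tdX) _.
by apply/bigmax_leqP => t _; rewrite independence_number_induced.
Qed.

Lemma card_bag_td_width (G T : sgraph) (X : T -> {set G}) (t : T) :
  #|X t| <= (td_width X).+1.
Proof. by apply: leq_trans (leqSpred _); apply: (leq_bigmax t). Qed.

Lemma min_degree_le_treewidth (G : sgraph) d :
  0 < #|G| -> (forall v : G, d <= #|neighborhood v|) -> d <= treewidth G.
Proof.
move=> G_gt0 deg; have [T [X [tdX <-]]] := treewidth_attained G.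
have [v [t /subset_leq_card]] := bag_contains_closed_neighborhood tdX G_gt0.
rewrite cardsU1 inE adj_irrefl => /leq_trans /(_ (card_bag_td_width X t)).
exact: leq_trans (deg v).
Qed.

Lemma tree_alpha_le_treewidth (G : sgraph) : tree_alpha G <= (treewidth G).+1.
Proof.
have [T [X [tdX <-]]] := treewidth_attained G; apply/tree_alpha_leP; exists T, X.
split=> // t; apply: leq_trans (largest_card_le_card _ _) _.
exact: card_bag_td_width.
Qed.

Lemma restrict_tree_decomposition (G T : sgraph) (X : T -> {set G}) (S : {set G}) :
  is_tree_decomposition X ->
  is_tree_decomposition (fun t => [set x : induced S | val x \in X t]).
Proof.
case=> treeT cover edge conn; split=> //.
- by move=> v; have [t vt] := cover (val v); exists t; rewrite inE.
- by move=> u v /edge[t]; exists t; rewrite !inE.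
move=> v; have -> : [set t | v \in [set x : induced S | val x \in X t]] =
    [set t | val v \in X t] by apply/setP => t; rewrite !inE.
exact: conn.
Qed.

Lemma treewidth_lt_ramsey (G : sgraph) (S : {set G}) :
  treewidth (induced S) < 2 ^ (omega S + tree_alpha G).
Proof.
have /tree_alpha_leP[T [X [tdX alphaX]]] := leqnn (tree_alpha G).
have pow_gt0 : 0 < 2 ^ (omega S + tree_alpha G) by rewrite expn_gt0.
rewrite (leq_ltn_trans (treewidth_le_td_width (restrict_tree_decomposition S tdX))) //.
rewrite /td_width -(prednK pow_gt0) ltnS -!subn1 leq_sub2r //.
apply/bigmax_leqP => t _; set A := [set x | _].
have AX : val @: A \subset X t by apply/subsetP => _ /imsetP[x + ->]; rewrite inE.
have AS : val @: A \subset S by apply/subsetP => _ /imsetP[x _ ->]; apply: valP.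
rewrite -(card_imset _ val_inj); apply: ltnW; apply: leq_trans (ramsey _) _.
rewrite leq_exp2l // leq_add ?largest_cardS //.
by apply: leq_trans (alphaX t); apply: largest_cardS.
Qed.

Lemma extend_tree_decomposition (G T : sgraph) (D : {set G})
    (X : T -> {set induced (~: D)}) :
  is_tree_decomposition X -> is_tree_decomposition (fun t => val @: X t :|: D).
Proof.
case=> treeT cover edge conn.
have [[/card_gt0P[t0 _] _] _] := treeT.
have mem_bag (v : induced (~: D)) t : (val v \in val @: X t :|: D) = (v \in X t).
  have /negPf vD : val v \notin D by rewrite -in_setC; apply: valP.
  by rewrite in_setU vD orbF; apply/mem_imset/val_inj.
have node_of v : exists t, v \in val @: X t :|: D.
  case: (boolP (v \in D)) => [vD|]; first by exists t0; rewrite inE vD orbT.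
  rewrite -in_setC => vD; have [t vt] := cover (exist _ v vD).
  by exists t; rewrite -mem_bag in vt.
split=> // [u v uv|v].
  case: (boolP (u \in D)) => [uD|uD].
    by have [t vt] := node_of v; exists t; rewrite vt inE uD orbT.
  case: (boolP (v \in D)) => [vD|vD].
    by have [t ut] := node_of u; exists t; rewrite ut inE vD orbT.
  rewrite -!in_setC in uD vD.
  have [t uvt] := edge (exist _ u uD) (exist _ v vD) uv.
  by exists t; rewrite -!mem_bag in uvt.
case: (boolP (v \in D)) => [vD|].
  have -> : [set t | v \in val @: X t :|: D] = setT.
    by apply/setP => t; rewrite !inE vD orbT.
  apply/connected_graph_induced; split; last exact: connected_in_setT treeT.1.
  by apply/card_gt0P; exists t0.
rewrite -in_setC => vD; have := conn (exist _ v vD).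
by under eq_finset do rewrite -mem_bag.
Qed.

Lemma tree_alpha_deletion (G : sgraph) (D : {set G}) :
  tree_alpha G <= tree_alpha (induced (~: D)) + alpha D.
Proof.
have /tree_alpha_leP[T [X [tdX alphaX]]] := leqnn (tree_alpha (induced (~: D))).
apply/tree_alpha_leP; exists T, (fun t => val @: X t :|: D).
split=> [|t]; first exact: extend_tree_decomposition.
apply: leq_trans (largest_cardU (@stableS G) _ _) _.
by rewrite leq_add2r alpha_imset_val.
Qed.

(** * Induced bicliques *)

Definition induced_biclique (G : sgraph) (A B : {set G}) : Prop :=
  [/\ is_stable A, is_stable B & {in A & B, forall x y, adj x y}].

Definition biclique_free (G : sgraph) (p : nat) : Prop :=
  forall A B : {set G}, induced_biclique A B -> minn #|A| #|B| < p.

Lemma biclique_free_gt0 (G : sgraph) p : biclique_free G p -> 0 < p.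
Proof.
move=> noK; apply: leq_trans (noK set0 set0 _); rewrite ?cards0 //.
by split; rewrite ?stable0 // => x y; rewrite inE.
Qed.

Lemma card_clique_stable (G : sgraph) (K A : {set G}) :
  is_clique K -> is_stable A -> #|K :&: A| <= 1.
Proof.
move=> /cliqueP clK /stableP stA; apply/card_le1_eqP => x y /setIP[xK xA] /setIP[yK yA].
by apply/eqP; apply: contraT => xy; case/negP: (stA y x yA xA); rewrite clK // eq_sym.
Qed.

Lemma omega_biclique (G : sgraph) (A B : {set G}) :
  induced_biclique A B -> omega (A :|: B) <= 2.
Proof.
case=> stA stB _; apply/largest_card_leP => K KAB clK.
rewrite -(setIidPl KAB) setIUr; apply: leq_trans (leq_card_setU _ _) _.
exact: leq_add (card_clique_stable clK stA) (card_clique_stable clK stB).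
Qed.

Lemma treewidth_biclique (G : sgraph) (A B : {set G}) :
  induced_biclique A B -> minn #|A| #|B| <= treewidth (induced (A :|: B)).
Proof.
case=> _ _ adjAB; have [->|A_neq0] := eqVneq A set0; first by rewrite cards0 min0n.
apply: min_degree_le_treewidth => [|v].
  by rewrite card_induced (leq_trans _ (subset_leq_card (subsetUl _ _))) ?card_gt0.
have card_nbhd (C : {set G}) : C \subset A :|: B ->
    {in C, forall u, adj (val v) u} -> #|C| <= #|neighborhood v|.
  move=> CAB vC; rewrite -(card_imset _ val_inj); apply/subset_leq_card/subsetP => u uC.
  apply/imsetP; exists (exist _ u (subsetP CAB u uC)) => //.
  by rewrite inE; apply: vC.
rewrite geq_min; have /setUP[vA|vB] := valP v.
  by rewrite orbC card_nbhd ?subsetUr // => u; apply: adjAB.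
by rewrite card_nbhd ?subsetUl // => u uA; rewrite adj_sym adjAB.
Qed.

(** * Weights of set families *)

Definition weight (T : finType) (w : T -> nat) (A : {set T}) : nat :=
  \sum_(x in A) w x.

Lemma weightS (T : finType) (w : T -> nat) :
  {homo weight w : A B / A \subset B >-> A <= B}.
Proof.
by move=> A B /subsetP AB; apply: sub_le_big => // x y; apply: leq_addr.
Qed.

Lemma weight_setI (T : finType) (w : T -> nat) (A B : {set T}) :
  weight w (A :&: B) = \sum_(x in A) if x \in B then w x else 0.
Proof. by rewrite -big_mkcondr; apply: eq_bigl => x; rewrite inE. Qed.

Lemma weight_bigcup (I T : finType) (w : T -> nat) (B : {set I}) (A : I -> {set T}) :
  weight w (\bigcup_(i in B) A i) <= \sum_(i in B) weight w (A i).
Proof.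
elim/big_ind2: _ => [|a S b S' wS wS'|//]; first by rewrite /weight big_set0.
apply: leq_trans (leq_add wS wS'); rewrite /weight (big_setID S) /= setUK.
by rewrite leq_add2l setDUl setDv set0U weightS ?subsetDl.
Qed.

Lemma leq_card_bigcup (I T : finType) (B : {set I}) (A : I -> {set T}) :
  #|\bigcup_(i in B) A i| <= \sum_(i in B) #|A i|.
Proof.
rewrite -sum1_card; apply: leq_trans (weight_bigcup (fun=> 1) _ _) _.
by apply: leq_sum => i _; rewrite -sum1_card.
Qed.

Definition meeting (T : finType) (Z : {set T}) : {set {set T}} :=
  [set Q : {set T} | ~~ [disjoint Z & Q]].

Lemma meetingP (T : finType) (Z Q : {set T}) :
  reflect (exists2 x, x \in Z & x \in Q) (Q \in meeting Z).
Proof.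
rewrite inE -setI_eq0; apply: (iffP (set0Pn _)) => [[x /setIP[]]|[x xZ xQ]].
  by exists x.
by exists x; apply/setIP.
Qed.

Lemma meeting_bigcup (I T : finType) (B : {set I}) (Z : I -> {set T}) :
  meeting (\bigcup_(i in B) Z i) = \bigcup_(i in B) meeting (Z i).
Proof.
apply/setP => Q; apply/meetingP/bigcupP => [[x /bigcupP[i iB xZ] xQ]|].
  by exists i => //; apply/meetingP; exists x.
by case=> i iB /meetingP[x xZ xQ]; exists x => //; apply/bigcupP; exists i.
Qed.

Lemma exists_independent_dominating (T : finType) (r : rel T) (L : {set T}) :
  symmetric r -> {in L, reflexive r} ->
  exists A : {set T}, [/\ A \subset L, {in A &, forall x y, r x y -> x = y} &
    {in L, forall x, exists2 y, y \in A & r y x}].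
Proof.
move=> r_sym r_refl.
pose independent := [pred A : {set T} |
  (A \subset L) && `[< {in A &, forall x y, r x y -> x = y} >]].
have [|A /maxsetP[/andP[AL /asboolP indA] maxA]] := @ex_maxset T independent.
  by exists set0; rewrite /= sub0set; apply/asboolP => x y; rewrite inE.
exists A; split=> // x xL; apply: contrapT => not_dominated.
have xA : x |: A = A.
  apply: maxA; last exact: subsetUr.
  rewrite /= subUset sub1set xL AL; apply/asboolP => y z.
  case/setU1P=> [->|yA] /setU1P[->|zA] // ryz; last exact: indA.
  - by case: not_dominated; exists z; rewrite // r_sym.
  - by case: not_dominated; exists y.
by case: not_dominated; exists x; rewrite ?r_refl // -xA setU11.
Qed.

Definition dominated (G : sgraph) (P : {set G}) : {set G} :=
  \bigcup_(v in P) closed_neighborhood v.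

Definition touch (G : sgraph) : rel {set G} :=
  fun P Q => Q \in meeting (dominated P).

Lemma sub_dominated (G : sgraph) (P : {set G}) : P \subset dominated P.
Proof. by apply/subsetP => v vP; apply/bigcupP; exists v; rewrite ?setU11. Qed.

Lemma in_dominated (G : sgraph) (P : {set G}) (v : G) :
  (v \in dominated P) = (P \in meeting (closed_neighborhood v)).
Proof.
by apply/bigcupP/meetingP => -[u]; exists u; rewrite // closed_neighborhood_sym.
Qed.

Lemma touchP (G : sgraph) (P Q : {set G}) :
  reflect (exists u v, [/\ u \in P, v \in Q & u \in closed_neighborhood v]) (touch P Q).
Proof.
apply: (iffP (meetingP _ _)) => [[v /bigcupP[u uP vu] vQ]|[u [v [uP vQ uv]]]].
  by exists u, v; rewrite closed_neighborhood_sym.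
by exists v => //; apply/bigcupP; exists u; rewrite // closed_neighborhood_sym.
Qed.

Lemma touch_sym (G : sgraph) : symmetric (@touch G).
Proof.
by move=> P Q; apply/touchP/touchP => -[u [v [uP vQ uv]]]; exists v, u;
  rewrite closed_neighborhood_sym.
Qed.

Lemma touchxx (G : sgraph) (Q : {set G}) : Q != set0 -> touch Q Q.
Proof.
by case/set0Pn=> v vQ; apply/meetingP; exists v; rewrite // (subsetP (sub_dominated Q)).
Qed.

Definition pairwise_anticomplete (G : sgraph) (A : {set {set G}}) : Prop :=
  {in A &, forall P Q, touch P Q -> P = Q}.

Definition anticomplete_free (G : sgraph) (F : {set {set G}}) (m : nat) : Prop :=
  forall A : {set {set G}}, A \subset F -> pairwise_anticomplete A -> #|A| < m.

Lemma anticomplete_free_gt0 (G : sgraph) (F : {set {set G}}) m :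
  anticomplete_free F m -> 0 < m.
Proof.
by move=> noA; apply: leq_trans (noA set0 (sub0set _) _) => // P Q; rewrite inE.
Qed.

(** * Vertex sets of bounded independence number and large weight *)

Section Popular.
Variables (G : sgraph) (p : nat) (J : {set G}).
Hypothesis stJ : is_stable J.

Definition popular : {set G} := [set u | p <= #|neighborhood u :&: J|].

(* By pigeonhole, a large stable set of popular vertices contains [p] vertices
   with the same neighbors in [J], which form an induced biclique. *)
Lemma alpha_popular : biclique_free G p -> alpha popular <= 2 ^ #|J| * p.
Proof.
move=> G_free; apply/largest_card_leP => I I_popular stI.
pose nbrs u := neighborhood u :&: J.
rewrite -card_powerset -sum_nat_const -sum1_card.
rewrite (partition_big nbrs (mem (powerset J))) => [|u _]; last first.
  by rewrite /= powersetE subsetIr.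
apply: leq_sum => M _; rewrite sum1dep_card; set I_M := [set u | _].
have [->|/set0Pn[u0]] := eqVneq I_M set0; first by rewrite cards0.
rewrite inE => /andP[u0I /eqP M_eq].
have cardM : p <= #|M| by have := subsetP I_popular u0 u0I; rewrite inE -M_eq.
rewrite leqNgt; apply/negP => cardIM; suff : minn #|I_M| #|M| < p.
  by rewrite ltnNge leq_min cardM (ltnW cardIM).
apply: G_free; split=> [||u v].
- by apply: stableS stI; apply/subsetP => u; rewrite inE => /andP[].
- by apply: stableS stJ; rewrite -M_eq subsetIr.
by rewrite inE => /andP[_ /eqP <-] /setIP[]; rewrite inE.
Qed.

Hypothesis p_gt0 : 0 < p.

Lemma card_closed_neighborhood_unpopular (u : G) :
  u \notin popular -> #|closed_neighborhood u :&: J| <= p.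
Proof.
rewrite inE -ltnNge => u_unpopular; case: (boolP (u \in J)) => uJ.
  apply: leq_trans p_gt0; rewrite -(cards1 u) subset_leq_card //.
  apply/subsetP => v /setIP[+ vJ]; rewrite in_setU1 !inE => /predU1P[->//|uv].
  by have /stableP/(_ u v uJ vJ) := stJ; rewrite uv.
apply: leq_trans (ltnW u_unpopular); apply/subset_leq_card/subsetP => v.
case/setIP=> /setU1P[->|uv] vJ; first by rewrite vJ in uJ.
by rewrite inE uv.
Qed.

Lemma card_dominated_unpopular (Q : {set G}) :
  Q \notin meeting popular -> #|dominated Q :&: J| <= #|Q| * p.
Proof.
move=> not_met; rewrite /dominated big_distrl /=.
apply: leq_trans (leq_card_bigcup _ _) _; rewrite -sum_nat_const.
apply: leq_sum => u uQ; apply: card_closed_neighborhood_unpopular.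
by apply: contra not_met => u_popular; apply/meetingP; exists u.
Qed.

End Popular.

Section HeavySet.
Variables (G : sgraph) (s m : nat) (F : {set {set G}}) (w : {set G} -> nat).
Hypothesis F_neq0 : {in F, forall Q : {set G}, Q != set0}.
Hypothesis F_card : {in F, forall Q : {set G}, #|Q| <= s}.
Hypothesis F_anticomplete : anticomplete_free F m.

Definition heavy_members : {set {set G}} :=
  [set Q in F | weight w F <= 2 * m * weight w (F :&: meeting (dominated Q))].

Definition heavy_vertices (c : nat) : {set G} :=
  [set v | weight w F <= c * weight w (F :&: meeting (closed_neighborhood v))].

(* The light members are touched by a maximal anticomplete family of them, which
   has few members, each touching little weight. *)
Lemma weight_heavy_members : weight w F <= 2 * weight w heavy_members.
Proof.
pose L := F :\: heavy_members.
have LF : L \subset F by apply: subsetDl.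
have [||A [AL antiA coverA]] := @exists_independent_dominating _ (@touch G) L.
- exact: touch_sym.
- by move=> Q /(subsetP LF) QF; apply/touchxx/F_neq0.
have L_le : weight w L <= \sum_(P in A) weight w (F :&: meeting (dominated P)).
  apply: leq_trans (weight_bigcup _ _ _); apply: weightS; apply/subsetP => Q QL.
  have [P PA PQ] := coverA Q QL.
  by apply/bigcupP; exists P; rewrite // in_setI (subsetP LF Q QL).
have A_light : 2 * m * \sum_(P in A) weight w (F :&: meeting (dominated P))
    <= #|A| * weight w F.
  rewrite big_distrr -sum_nat_const leq_sum //= => P /(subsetP AL).
  by rewrite !in_setD inE => /andP[+ PF]; rewrite PF -ltnNge => /ltnW.
have W_split : weight w F = weight w heavy_members + weight w L.
  rewrite /weight (big_setID heavy_members); congr (_ + _); apply: eq_bigl => Q.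
  by rewrite !inE; case: (Q \in F).
have cardA := F_anticomplete (subset_trans AL LF) antiA.
have : m * (2 * weight w L) <= m * weight w F.
  rewrite mulnCA mulnA (leq_trans (leq_mul (leqnn _) L_le)) //.
  by rewrite (leq_trans A_light) // leq_mul2r (ltnW cardA) orbT.
rewrite leq_pmul2l ?(leq_trans _ cardA) //; lia.
Qed.

Lemma heavy_members_sub_meeting :
  heavy_members \subset meeting (heavy_vertices (2 * m * s)).
Proof.
apply/subsetP => Q; rewrite inE => /andP[QF Q_heavy]; apply: contraT => not_met.
have light v : v \in Q ->
    2 * m * s * weight w (F :&: meeting (closed_neighborhood v)) < weight w F.
  move=> vQ; rewrite ltnNge; apply: contra not_met => v_heavy.
  by apply/meetingP; exists v; rewrite // inE.
have Q_le : weight w (F :&: meeting (dominated Q)) <=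
    \sum_(v in Q) weight w (F :&: meeting (closed_neighborhood v)).
  by rewrite meeting_bigcup big_distrr weight_bigcup.
have sum_light :
    2 * m * s * \sum_(v in Q) weight w (F :&: meeting (closed_neighborhood v)) + #|Q|
      <= #|Q| * weight w F.
  rewrite -[X in _ + X <= _]sum1_card -sum_nat_const big_distrr -big_split /=.
  by apply: leq_sum => v /light; rewrite addn1.
have Q_gt0 : 0 < #|Q| by rewrite card_gt0 F_neq0.
have W_le : s * weight w F <=
    2 * m * s * \sum_(v in Q) weight w (F :&: meeting (closed_neighborhood v)).
  rewrite mulnAC mulnC leq_mul2r (leq_trans Q_heavy) ?orbT //.
  by rewrite leq_mul2l Q_le orbT.
have := leq_mul (F_card QF) (leqnn (weight w F)); lia.
Qed.

(* Double counting the pairs of a vertex of [J] and a member of [F] that it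
   dominates. *)
Lemma weight_meeting_popular (p c : nat) (J : {set G}) :
  0 < p -> is_stable J -> J \subset heavy_vertices c ->
  #|J| * weight w F <=
    c * (#|J| * weight w (F :&: meeting (popular p J)) + s * p * weight w F).
Proof.
move=> p_gt0 stJ J_heavy.
have J_le : #|J| * weight w F <=
    c * \sum_(v in J) weight w (F :&: meeting (closed_neighborhood v)).
  rewrite -sum_nat_const big_distrr leq_sum //= => v /(subsetP J_heavy).
  by rewrite inE.
have double_count : \sum_(v in J) weight w (F :&: meeting (closed_neighborhood v)) =
    \sum_(Q in F) w Q * #|dominated Q :&: J|.
  under eq_bigr do rewrite weight_setI.
  rewrite exchange_big; apply: eq_bigr => Q _ /=.
  rewrite -big_mkcondr sum_nat_const mulnC; congr (_ * _); apply: eq_card => v.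
  by rewrite in_setI in_dominated andbC.
apply: leq_trans J_le _; rewrite leq_mul2l double_count; apply/orP; right.
rewrite weight_setI /weight !big_distrr -big_split.
apply: leq_sum => Q QF /=; case: ifPn => [_|not_met].
  rewrite mulnC (leq_trans _ (leq_addr _ _)) // leq_mul2r.
  by rewrite subset_leq_card ?subsetIr ?orbT.
have card_le := card_dominated_unpopular stJ p_gt0 not_met.
rewrite muln0 add0n mulnC leq_mul2r (leq_trans card_le) ?orbT //.
by rewrite leq_mul2r F_card ?orbT.
Qed.

Definition heavy_alpha (p : nat) : nat := 2 ^ (4 * m * s ^ 2 * p) * p.

Lemma exists_heavy_set (p : nat) : 0 < s -> biclique_free G p ->
  exists2 Z : {set G}, alpha Z <= heavy_alpha p &
    weight w F <= 4 * m * s * weight w (F :&: meeting Z).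
Proof.
move=> s_gt0 G_free; have p_gt0 := biclique_free_gt0 G_free.
have m_gt0 := anticomplete_free_gt0 F_anticomplete.
pose c := 2 * m * s; pose n := 4 * m * s ^ 2 * p.
have [n_le|alpha_lt] := leqP n (alpha (heavy_vertices c)).
  have [J J_heavy [stJ cardJ]] := exists_card_largest (stable0 G) (@stableS G) n_le.
  exists (popular p J); first by rewrite /heavy_alpha -/n -cardJ alpha_popular.
  have n_eq : n = 2 * (c * (s * p)) by rewrite /n /c; lia.
  have n_gt0 : 0 < n by rewrite /n !muln_gt0 m_gt0 s_gt0.
  have := weight_meeting_popular p_gt0 stJ J_heavy; rewrite cardJ => J_le.
  have absorb : 2 * (c * (s * p * weight w F)) = n * weight w F by rewrite n_eq; lia.
  rewrite -(leq_pmul2l n_gt0); rewrite /c in J_le absorb; lia.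
exists (heavy_vertices c).
  apply: leq_trans (ltnW alpha_lt) _; rewrite /heavy_alpha -/n.
  by rewrite (leq_trans (ltnW (ltn_expl n (ltnSn 1)))) // leq_pmulr.
have heavy_le : weight w heavy_members <= weight w (F :&: meeting (heavy_vertices c)).
  apply: weightS; rewrite subsetI heavy_members_sub_meeting andbT.
  by apply/subsetP => Q; rewrite inE => /andP[].
apply: leq_trans weight_heavy_members _.
apply: leq_trans (leq_mul (leqnn 2) heavy_le) _; rewrite leq_mul2r -mulnA.
by rewrite (leq_trans (_ : 2 <= 4 * 1)) ?orbT // leq_mul2l muln_gt0 m_gt0.
Qed.

End HeavySet.

(** * Multiplicative weights *)

Lemma double_expn b : 0 < b -> 2 * b ^ b <= b.+1 ^ b.
Proof.
case: b => // b _; rewrite -[b.+2]addn1 expnDn !big_ord_recl /= addnA.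
apply: leq_trans (leq_addr _ _).
by rewrite !exp1n bin0 bin1 !muln1 mul1n subn0 subSS subn0 -expnS addnn mul2n.
Qed.

Definition boost_rounds (a : nat) : nat := (2 * a).-1 * 2.

Lemma leq_expn_boost_rounds a L :
  0 < a -> 4 ^ L * (2 * a).-1 ^ (boost_rounds a * L) <= (2 * a) ^ (boost_rounds a * L).
Proof.
move=> a_gt0; rewrite /boost_rounds; set b := (2 * a).-1.
have [-> b_gt0] : 2 * a = b.+1 /\ 0 < b by rewrite /b; lia.
case: L => [|L]; first by rewrite muln0.
rewrite !(expnM _ _ L.+1) -expnMn leq_exp2r // !(expnM _ _ 2).
by rewrite -[4]/(2 ^ 2) -expnMn leq_exp2r // double_expn.
Qed.

Section MultiplicativeWeights.
Variables (I : finType) (Z : eqType) (F : {set I}) (hit : Z -> {set I}).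
Variables (good : Z -> Prop) (a : nat).
Hypothesis a_gt0 : 0 < a.
Hypothesis good_hit : forall w : I -> nat,
  exists2 z, good z & weight w F <= a * weight w (F :&: hit z).

Let misses (zs : seq Z) (i : I) : nat := count (fun z => i \notin hit z) zs.

(* Doubling the weights of the elements missed in each round makes the total
   weight grow by a factor [2 - 1/a] only. *)
Lemma weight_misses T : exists zs : seq Z,
  [/\ size zs = T, {in zs, forall z, good z} &
   a ^ T * weight (fun i => 2 ^ misses zs i) F <= (2 * a).-1 ^ T * #|F|].
Proof.
elim: T => [|T [zs [size_zs good_zs potential]]].
  by exists [::]; split=> //; rewrite /weight sum1_card.
have [z good_z hit_z] := good_hit (fun i => 2 ^ misses zs i).
exists (z :: zs); split; first by rewrite /= size_zs.
  by move=> y; rewrite inE => /predU1P[->|/good_zs].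
have grow : weight (fun i => 2 ^ misses (z :: zs) i) F +
    weight (fun i => 2 ^ misses zs i) (F :&: hit z) =
    2 * weight (fun i => 2 ^ misses zs i) F.
  rewrite weight_setI /weight -big_split big_distrr; apply: eq_bigr => i _ /=.
  by rewrite expnD; case: (i \in hit z); rewrite ?expn0 ?expn1; lia.
have step : a * weight (fun i => 2 ^ misses (z :: zs) i) F <=
    (2 * a).-1 * weight (fun i => 2 ^ misses zs i) F.
  by move: grow hit_z; move: (weight _ _) (weight _ _) (weight _ _); nia.
rewrite !expnSr -mulnA (leq_trans (leq_mul (leqnn _) step)) //.
by rewrite mulnCA [leqRHS]mulnAC [leqRHS]mulnC leq_mul2l potential orbT.
Qed.

Lemma fractional_cover : exists (L : nat) (zs : seq Z),
  [/\ 0 < L, size zs = boost_rounds a * L, {in zs, forall z, good z} &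
      {in F, forall i, L <= count (fun z => i \in hit z) zs}].
Proof.
pose L := #|F|.+1; have F_lt : #|F| < 2 ^ L by apply: ltnW; apply: ltn_expl.
have [zs [size_zs good_zs potential]] := weight_misses (boost_rounds a * L).
exists L, zs; split=> // i iF; set T := boost_rounds a * L in size_zs potential.
have miss_le : 2 ^ misses zs i <= weight (fun i => 2 ^ misses zs i) F.
  by rewrite /weight (bigD1 i iF) leq_addr.
suff : 2 ^ (L + misses zs i) <= 2 ^ T.
  by rewrite leq_exp2l // -size_zs -(count_predC (fun z => i \in hit z)) leq_add2r.
have aT_gt0 : 0 < a ^ T * 2 ^ L by rewrite muln_gt0 !expn_gt0 a_gt0.
rewrite -(leq_pmul2l aT_gt0) expnD.
have -> : a ^ T * 2 ^ L * (2 ^ L * 2 ^ misses zs i) = 4 ^ L * (a ^ T * 2 ^ misses zs i).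
  by rewrite -[4]/(2 * 2) expnMn; lia.
have -> : a ^ T * 2 ^ L * 2 ^ T = (2 * a) ^ T * 2 ^ L by rewrite expnMn; lia.
apply: leq_trans (leq_mul (leq_expn_boost_rounds L a_gt0) (ltnW F_lt)).
rewrite -mulnA leq_mul2l; apply/orP; right; apply: leq_trans potential.
by rewrite leq_mul2l miss_le orbT.
Qed.

End MultiplicativeWeights.

Section FrequentVertices.
Variables (G : sgraph) (s L : nat) (zs : seq {set G}).

Let frequency (v : G) : nat := count (fun Z : {set G} => v \in Z) zs.

Definition frequent : {set G} := [set v | L <= s * frequency v].

Lemma sum_frequency (A : {set G}) :
  \sum_(v in A) frequency v = \sum_(Z <- zs) #|A :&: Z|.
Proof.
under eq_bigr do rewrite /frequency -sum1_count big_mkcond.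
rewrite exchange_big /=; apply: eq_bigr => Z _.
by rewrite -big_mkcondr sum1dep_card; apply: eq_card => v; rewrite !inE.
Qed.

Lemma alpha_frequent b :
  {in zs, forall Z, alpha Z <= b} -> L * alpha frequent <= s * (size zs * b).
Proof.
move=> alpha_le; have [J /subsetP J_freq [stJ <-]] :=
  exists_card_largest (stable0 G) (@stableS G) (leqnn (alpha frequent)).
have : #|J| * L <= s * \sum_(v in J) frequency v.
  by rewrite -sum_nat_const big_distrr leq_sum //= => v /J_freq; rewrite inE.
rewrite mulnC => /leq_trans-> //; rewrite leq_mul2l sum_frequency; apply/orP; right.
rewrite -sum1_size big_distrl big_seq [leqRHS]big_seq leq_sum //= => Z /alpha_le.
rewrite mul1n; apply: leq_trans; apply: card_le_largest (subsetIr _ _) _.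
exact: stableS (subsetIl _ _) stJ.
Qed.

Lemma meeting_frequent (Q : {set G}) :
  0 < L -> #|Q| <= s -> L <= count (fun Z => Q \in meeting Z) zs ->
  Q \in meeting frequent.
Proof.
move=> L_gt0 cardQ Q_met; apply: contraT => not_met.
have L_le : L <= \sum_(v in Q) frequency v.
  rewrite sum_frequency (leq_trans Q_met) // -sum1_count big_mkcond.
  apply: leq_sum => Z _; case: ifP => // /meetingP[v vZ vQ].
  by apply/card_gt0P; exists v; rewrite inE vQ.
have : s * \sum_(v in Q) frequency v <= #|Q| * L.-1.
  rewrite -sum_nat_const big_distrr leq_sum //= => v vQ.
  rewrite -ltnS (prednK L_gt0) ltnNge; apply: contra not_met => v_freq.
  by apply/meetingP; exists v; rewrite // inE.
move=> freq_le; have : s * L <= s * L.-1.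
  rewrite (leq_trans (leq_mul (leqnn s) L_le)) // (leq_trans freq_le) //.
  by rewrite leq_mul2r cardQ orbT.
have Q_gt0 : 0 < #|Q|.
  rewrite card_gt0; apply: contraTneq L_le => ->.
  by rewrite big_set0 leqNgt L_gt0.
by rewrite leq_pmul2l ?(leq_trans Q_gt0) // leqNgt prednK // leqnn.
Qed.

End FrequentVertices.

Definition hitting_alpha (s m p : nat) : nat :=
  s * (boost_rounds (4 * m * s) * heavy_alpha s m p).

Lemma exists_hitting_set (G : sgraph) (s m p : nat) (F : {set {set G}}) :
  0 < s -> {in F, forall Q : {set G}, 0 < #|Q| <= s} ->
  anticomplete_free F m -> biclique_free G p ->
  exists2 D : {set G}, alpha D <= hitting_alpha s m p & F \subset meeting D.
Proof.
move=> s_gt0 F_card F_free G_free.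
have F_neq0 : {in F, forall Q : {set G}, Q != set0}.
  by move=> Q /F_card/andP[]; rewrite card_gt0.
have F_le : {in F, forall Q : {set G}, #|Q| <= s} by move=> Q /F_card/andP[].
have m_gt0 := anticomplete_free_gt0 F_free.
have [||L [zs [L_gt0 size_zs alpha_zs F_met]]] := @fractional_cover _ _ F (@meeting G)
    (fun Z => alpha Z <= heavy_alpha s m p) (4 * m * s).
- by rewrite !muln_gt0 m_gt0.
- by move=> w; apply: exists_heavy_set.
exists (frequent s L zs).
  rewrite -(leq_pmul2l L_gt0); apply: leq_trans (alpha_frequent s L alpha_zs) _.
  by rewrite size_zs /hitting_alpha; lia.
by apply/subsetP => Q QF; apply: meeting_frequent (F_met Q QF); rewrite ?F_le.
Qed.

(** * Excluding a clique partition graph *)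

Definition embedding (H G : sgraph) (f : H -> G) : Prop :=
  injective f /\ forall x y, adj (f x) (f y) = adj x y.

Lemma isomorphic_induced_codom (H G : sgraph) (f : H -> G) :
  embedding f -> isomorphic H (induced (f @: [set: H])).
Proof.
case=> f_inj f_adj.
exists (fun x => exist _ (f x) (imset_f f (in_setT x))).
split=> [|x y]; last exact: f_adj.
apply: inj_card_bij => [x y /(congr1 val)/f_inj //|].
by rewrite card_induced (card_imset _ f_inj) cardsT.
Qed.

Lemma isomorphic_sym (H G : sgraph) : isomorphic H G -> isomorphic G H.
Proof.
case=> f [[g fK gK] f_adj]; exists g; split; first by exists f.
by move=> x y; rewrite -f_adj !gK.
Qed.

Lemma in_class_embedding (C : graph_class) (H G : sgraph) (f : H -> G) :
  hereditary C -> embedding f -> C G -> C H.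
Proof.
move=> hC /isomorphic_induced_codom/isomorphic_sym isoH CG.
exact: in_class_iso isoH (hC G CG _).
Qed.

Lemma embedding_complete_graph (G : sgraph) (K : {set G}) n :
  is_clique K -> n <= #|K| ->
  exists f : complete_graph n -> G, embedding f /\ forall x, f x \in K.
Proof.
move=> /cliqueP clK nK; pose f (x : complete_graph n) := enum_val (widen_ord nK x).
have fK x : f x \in K by apply: enum_valP.
have f_inj : injective f by move=> x y /enum_val_inj/(congr1 val)/= /ord_inj.
exists f; split=> //; split=> // x y; rewrite /= /complete_adj.
by have [->|xy] := eqVneq x y; [rewrite adj_irrefl | rewrite clK ?fK ?(inj_eq f_inj)].
Qed.

Lemma embedding_disjoint_union (G : sgraph) (I : finType) (H : I -> sgraph)
    (f : forall i, H i -> G) :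
  (forall i, embedding (f i)) ->
  (forall i j x y, f i x \in closed_neighborhood (f j y) -> i = j) ->
  embedding (fun u : disjoint_union H => f (tag u) (tagged u)).
Proof.
move=> f_emb apart; split=> [[i x] [j y] /= fxy|[i x] [j y]] /=.
  have ij : i = j by apply: (apart i j x y); rewrite fxy setU11.
  by case: j / ij y fxy => y /(f_emb i).1->.
rewrite /disjoint_union_adj /=; have [ij|ij] := eqVneq i j.
  by case: j / ij y => y; rewrite tagged_asE (f_emb i).2.
apply: contra_neqF ij => fxy; apply: (apart i j x y).
by rewrite !inE adj_sym fxy orbT.
Qed.

Lemma embedding_clique_partition (G : sgraph) (I : finType) (n : I -> nat)
    (K : I -> {set G}) :
  (forall i, is_clique (K i)) -> (forall i, n i <= #|K i|) ->
  (forall i j, touch (K i) (K j) -> i = j) ->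
  exists f : disjoint_union (fun i => complete_graph (n i)) -> G, embedding f.
Proof.
move=> clK nK apart.
pose f i := sval (cid (embedding_complete_graph (clK i) (nK i))).
have fP i : embedding (f i) /\ forall x, f i x \in K i.
  exact: svalP (cid (embedding_complete_graph (clK i) (nK i))).
exists (fun u => f (tag u) (tagged u)).
apply: embedding_disjoint_union => [i|i j x y xy]; first exact: (fP i).1.
by apply: apart; apply/touchP; exists (f i x), (f j y); split=> //; apply: (fP _).2.
Qed.

Definition cliques (G : sgraph) (s : nat) : {set {set G}} :=
  [set Q : {set G} | is_clique Q && (#|Q| == s)].

Lemma excluded_clique_partition_anticomplete_free (C : graph_class) :
  hereditary C -> ~ contains_all_clique_partition_graphs C ->
  exists s, forall G : sgraph, C G ->
    anticomplete_free (cliques G s) s.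
Proof.
move=> hC /existsNP[P /not_implyP[[I [n isoP]] PC]].
pose s := #|I| + \sum_i n i; exists s => G CG A /subsetP A_sub antiA.
have AP Q : Q \in A -> is_clique Q /\ #|Q| = s.
  by move=> /A_sub; rewrite inE => /andP[? /eqP].
rewrite ltnNge; apply/negP => cardA; apply: PC.
have IA : #|I| <= #|A| by apply: leq_trans cardA; apply: leq_addr.
pose K i := enum_val (widen_ord IA (enum_rank i)).
have KA i : K i \in A by apply: enum_valP.
have [|i|i j|f f_emb] := @embedding_clique_partition G I n K.
- by move=> i; have [] := AP _ (KA i).
- by have [_ ->] := AP _ (KA i); rewrite /s (bigD1 i) //= addnCA leq_addr.
- move=> /(antiA _ _ (KA i) (KA j))/enum_val_inj/(congr1 val)/=.
  by move=> /ord_inj/enum_rank_inj.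
exact: in_class_iso (isomorphic_sym isoP) (in_class_embedding hC f_emb CG).
Qed.

Lemma bounded_tree_alpha_tw_omega_bounded (C : graph_class) :
  bounded_tree_alpha C -> tw_omega_bounded C.
Proof.
case=> k Ck; exists (fun w => 2 ^ (w + k)) => G CG S.
rewrite clique_number_induced; apply: leq_trans (ltnW (treewidth_lt_ramsey S)) _.
by rewrite leq_exp2l // leq_add2l Ck.
Qed.

Lemma tw_omega_bounded_omega_le (C : graph_class) w :
  tw_omega_bounded C -> exists k, forall G : sgraph, C G -> forall S : {set G},
    omega S <= w -> treewidth (induced S) <= k.
Proof.
case=> f Cf; exists (\max_(i < w.+1) f i) => G CG S; rewrite -ltnS => S_lt.
apply: leq_trans (Cf G CG S) _; rewrite clique_number_induced.
exact: (leq_bigmax (Ordinal S_lt)).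
Qed.

Lemma tw_omega_bounded_biclique_free (C : graph_class) :
  tw_omega_bounded C -> exists p, forall G : sgraph, C G -> biclique_free G p.
Proof.
move=> /(tw_omega_bounded_omega_le 2)[k Ck]; exists k.+1 => G CG A B AB.
exact: leq_trans (treewidth_biclique AB) (Ck G CG _ (omega_biclique AB)).
Qed.

Lemma omega_avoiding (G : sgraph) (D : {set G}) s :
  cliques G s \subset meeting D -> omega (~: D) <= s.
Proof.
move=> /subsetP D_meets; rewrite leqNgt; apply/negP => /ltnW.
case/(exists_card_largest (clique0 G) (@cliqueS G)) => K /subsetP KD [clK cardK].
have /D_meets/meetingP[x xD /KD] : K \in cliques G s.
  by rewrite inE clK cardK eqxx.
by rewrite inE xD.
Qed.

Lemma tw_omega_bounded_bounded_tree_alpha (C : graph_class) :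
  hereditary C -> ~ contains_all_clique_partition_graphs C ->
  tw_omega_bounded C -> bounded_tree_alpha C.
Proof.
move=> hC hP C_tw.
have [s C_anticomplete] := excluded_clique_partition_anticomplete_free hC hP.
have [p C_biclique] := tw_omega_bounded_biclique_free C_tw.
have [k C_k] := tw_omega_bounded_omega_le s C_tw.
exists (k.+1 + hitting_alpha s s p) => G CG.
have s_gt0 := anticomplete_free_gt0 (C_anticomplete G CG).
have [Q|D alphaD D_meets] :=
  exists_hitting_set s_gt0 _ (C_anticomplete G CG) (C_biclique G CG).
  by rewrite inE => /andP[_ /eqP->]; rewrite s_gt0 leqnn.
apply: leq_trans (tree_alpha_deletion D) (leq_add _ alphaD).
apply: leq_trans (tree_alpha_le_treewidth _) _.
by rewrite ltnS C_k // omega_avoiding.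
Qed.

Theorem theorem3p2 (C : graph_class)
    (hC : hereditary C)
    (hP : ~ contains_all_clique_partition_graphs C) :
  tw_omega_bounded C <-> bounded_tree_alpha C.
Proof.
split; first exact: tw_omega_bounded_bounded_tree_alpha.
exact: bounded_tree_alpha_tw_omega_bounded.
Qed.
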